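(* Let $\mathsf{Cat}_2\subseteq\mathsf{Banach}\subseteq\mathsf{Cat}_1$ be metric-algebraic categories such that $\mathsf{Cat}_1$ is nice, $\mathsf{Cat}_2$ is closed under biduals, and every object $X$ of $\mathsf{Cat}_1$ has a free object $(\delta_X,F[X])$ in $\mathsf{Cat}_2$, with associated functor $F$. Let $i\colon N\to M$ be a $\mathsf{Cat}_1$-morphism, and let $j\colon F[N]\to F[N]^{**}$ be the canonical embedding, where $F[N]^{**}$ carries a $\mathsf{Cat}_2$-structure as given by closedness under biduals. The following are equivalent: (1) $F[i]\colon F[N]\to F[M]$ is an isomorphic embedding of Banach spaces whose range is locally complemented in $F[M]$. (2) For every dual Banach space $Z^*$ admitting a $\mathsf{Cat}_2$-structure (i.e. extra operations making $Z^*$ a $\mathsf{Cat}_2$-object) and every $\mathsf{Cat}_1$-morphism $f\colon N\to Z^*$ there exists a $\mathsf{Cat}_1$-morphism $h\colon M\to Z^*$ with $h\circ i=f$. (3) There exists a $\mathsf{Cat}_1$-morphism $h\colon M\to F[N]^{**}$ with $h\circ i=j\circ\delta_N$. (4) There exists a $\mathsf{Cat}_2$-morphism $T\colon F[M]\to F[N]^{**}$ with $T\circ F[i]=j$.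
   Context: A metric-algebraic category is specified by arities $n_i$ ($i\in I$) and axioms; objects are $(X,d,\{\sigma_i\})$ with $d$ a metric and $\sigma_i\colon X^{n_i}\to X$ satisfying the axioms; morphisms are Lipschitz maps (norm $\|T\|$ = Lipschitz constant) commuting with the operations. $\mathsf{Cat}_2\subseteq\mathsf{Cat}_1$ means that the operations and axioms of $\mathsf{Cat}_2$ contain those of $\mathsf{Cat}_1$, so $\mathsf{Cat}_2$-objects/morphisms are $\mathsf{Cat}_1$-objects/morphisms. $\mathsf{Banach}$: real Banach spaces, operations = linear combinations, morphisms = bounded operators (e.g. $\mathsf{Cat}_2$ could be Banach lattices with lattice homomorphisms, $\mathsf{Cat}_1$ could be pointed metric spaces with Lipschitz maps). $\mathsf{Cat}_1$ is nice if for every $\mathsf{Cat}_1$-morphism $f\colon A\to B$ and every $D\subseteq B$ that is a $\mathsf{Cat}_1$-object with inherited operations, $f^{-1}(D)$ is a $\mathsf{Cat}_1$-object with inherited operations. $\mathsf{Cat}_2\subseteq\mathsf{Banach}$ is closed under biduals if for every $\mathsf{Cat}_2$-object $Z$ the bidual $Z^{**}$ can be endowed with the remaining operations of $\mathsf{Cat}_2$ making it a $\mathsf{Cat}_2$-object such that the canonical embedding $Z\to Z^{**}$ is a $\mathsf{Cat}_2$-morphism. A free object generated by a $\mathsf{Cat}_1$-object $X$ in $\mathsf{Cat}_2$ is a pair $(\delta_X,F[X])$ with $F[X]$ a $\mathsf{Cat}_2$-object and $\delta_X\colon X\to F[X]$ a $\mathsf{Cat}_1$-morphism such that for every $\mathsf{Cat}_2$-object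 $Z$ and every $\mathsf{Cat}_1$-morphism $f\colon X\to Z$ there is a unique $\mathsf{Cat}_2$-morphism $T_f\colon F[X]\to Z$ with $T_f\circ\delta_X=f$ and $\|T_f\|=\|f\|$. For a $\mathsf{Cat}_1$-morphism $f\colon Y\to X$, $F[f]\colon F[Y]\to F[X]$ is the unique $\mathsf{Cat}_2$-morphism with $F[f]\circ\delta_Y=\delta_X\circ f$. A subspace $R$ of a Banach space $W$ is locally complemented if there is $\lambda\ge1$ such that for every finite-dimensional subspace $V\subseteq W$ and $\varepsilon>0$ there is a linear operator $T\colon V\to R$ with $T(v)=v$ for $v\in V\cap R$ and $\|T\|\le\lambda+\varepsilon$. *)

(* Defs.v *)
From HB Require Import structures.
From mathcomp Require Import all_boot all_order all_algebra.
From mathcomp Require Import all_classical all_reals all_analysis.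
From mathcomp Require Import Rstruct Rstruct_topology.

Set Implicit Arguments.
Unset Strict Implicit.
Unset Printing Implicit Defensive.

Import Order.TTheory GRing.Theory Num.Theory.
Import numFieldNormedType.Exports.
Local Open Scope classical_set_scope.
Local Open Scope ring_scope.

Notation RR := Rdefinitions.R.

Record signature := Signature { sidx : Type; sar : sidx -> nat }.

Definition opsT (S : signature) (X : Type) :=
  forall i : sidx S, ('I_(sar i) -> X) -> X.

Definition is_metric (X : Type) (d : X -> X -> RR) :=
  [/\ forall x y, 0 <= d x y,
      forall x y, d x y = 0 <-> x = y,
      forall x y, d x y = d y x &
      forall x y z, d x z <= d x y + d y z].

Record macat := MACat {
  ma_sig : signature;
  ma_ax : forall X : Type, (X -> X -> RR) -> opsT ma_sig X -> Prop }.

Record maobj (C : macat) := MAObj {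
  mcar :> Type;
  mdist : mcar -> mcar -> RR;
  mops : opsT (ma_sig C) mcar;
  mdist_metric : is_metric mdist;
  mobj_ax : @ma_ax C mcar mdist mops }.
Arguments mdist {C} m.
Arguments mops {C} m.

Definition lipschitz_with (X Y : Type) (dX : X -> X -> RR) (dY : Y -> Y -> RR)
  (L : RR) (f : X -> Y) := forall x y, dY (f x) (f y) <= L * dX x y.

Definition lipschitz (X Y : Type) (dX : X -> X -> RR) (dY : Y -> Y -> RR)
  (f : X -> Y) := exists L, 0 <= L /\ lipschitz_with dX dY L f.

Definition lipnorm (X Y : Type) (dX : X -> X -> RR) (dY : Y -> Y -> RR)
  (f : X -> Y) : RR := inf [set L : RR | 0 <= L /\ lipschitz_with dX dY L f].

Definition commutes_ops (S : signature) (X Y : Type) (oX : opsT S X)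
  (oY : opsT S Y) (f : X -> Y) :=
  forall (i : sidx S) (xs : 'I_(sar i) -> X), f (oX i xs) = oY i (f \o xs).

Definition is_mor (C : macat) (A B : maobj C) (f : A -> B) :=
  lipschitz (mdist A) (mdist B) f /\
  commutes_ops (mops A) (mops B) f.

Definition ops_closed (C : macat) (B : maobj C) (D : set B) :=
  forall (i : sidx (ma_sig C)) (xs : 'I_(sar i) -> B),
    (forall k, D (xs k)) -> D (mops B i xs).

Definition sub_ops (C : macat) (B : maobj C) (D : set B) (cl : ops_closed D)
  : opsT (ma_sig C) {x : B | D x} :=
  fun i xs => exist D (mops B i (fun k => proj1_sig (xs k)))
                      (cl i _ (fun k => proj2_sig (xs k))).

Definition is_subobj (C : macat) (B : maobj C) (D : set B) :=
  exists cl : ops_closed D,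
    @ma_ax C _ (fun x y : {x : B | D x} => mdist B (proj1_sig x) (proj1_sig y))
            (sub_ops cl).

Definition nice (C : macat) :=
  forall (A B : maobj C) (f : A -> B), is_mor f ->
  forall D : set B, is_subobj D -> is_subobj (f @^-1` D).

Definition lincomb (Z : completeNormedModType RR) (n : nat) (c : 'I_n -> RR)
  (xs : 'I_n -> Z) : Z := \sum_(k < n) c k *: xs k.

Definition normdist (Z : completeNormedModType RR) (x y : Z) : RR := `|x - y|.

Lemma normdist_metric (Z : completeNormedModType RR) : is_metric (@normdist Z).
Proof.
split=> [x y|x y|x y|x y z]; rewrite /normdist.
- exact: normr_ge0.
- split=> [/eqP|->]; last by rewrite subrr normr0.
  by rewrite normr_eq0 subr_eq0 => /eqP.
- exact: distrC.
- exact: ler_distD.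
Qed.

(** [Cat1 ⊇ Banach]: each operation symbol [i] of [Cat1] is the linear
    combination with coefficients [lc i], and every Banach space with these
    operations satisfies the axioms of [Cat1]. *)
Definition banach_in (C1 : macat)
  (lc : forall i : sidx (ma_sig C1), 'I_(sar i) -> RR) :=
  forall Z : completeNormedModType RR,
    @ma_ax C1 Z (@normdist Z) (fun i xs => lincomb (lc i) xs).

(** A metric-algebraic category [Cat2 ⊆ Banach]: the operations are the
    linear combinations plus extra operation symbols [b_sig], and the axioms
    are those of Banach spaces plus [b_ax]. *)
Record bcat := BCat {
  b_sig : signature;
  b_ax : forall Z : completeNormedModType RR, opsT b_sig Z -> Prop }.

Record bobj (C : bcat) := BObj {
  bcar :> completeNormedModType RR;
  bops : opsT (b_sig C) bcar;
  bobj_ax : @b_ax C bcar bops }.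
Arguments bops {C} b.

Definition is_linear (V W : completeNormedModType RR) (T : V -> W) :=
  forall (a : RR) (x y : V), T (a *: x + y) = a *: T x + T y.

(** [Cat2]-morphisms: Lipschitz maps commuting with all operations of [Cat2],
    i.e. bounded linear operators commuting with the extra operations. *)
Definition is_bmor (C : bcat) (A B : bobj C) (T : A -> B) :=
  [/\ is_linear T, lipschitz (@normdist A) (@normdist B) T &
      commutes_ops (bops A) (bops B) T].

Definition b_iso_invariant (C : bcat) :=
  forall (Z Z' : completeNormedModType RR) (g : Z -> Z')
         (o : opsT (b_sig C) Z) (o' : opsT (b_sig C) Z'),
    is_linear g -> bijective g -> (forall x, `|g x| = `|x|) ->
    commutes_ops o o' g -> @b_ax C Z o -> @b_ax C Z' o'.

Definition as_cat1 (C1 : macat) (lc : forall i : sidx (ma_sig C1), 'I_(sar i) -> RR)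
  (Hlc : banach_in lc) (C2 : bcat) (Z : bobj C2) : maobj C1 :=
  @MAObj C1 Z (@normdist Z) (fun i xs => lincomb (lc i) xs)
         (@normdist_metric Z) (Hlc Z).

Definition is_free_obj (C1 : macat)
  (lc : forall i : sidx (ma_sig C1), 'I_(sar i) -> RR) (Hlc : banach_in lc)
  (C2 : bcat) (X : maobj C1) (FX : bobj C2) (delta : X -> FX) :=
  @is_mor C1 X (as_cat1 Hlc FX) delta /\
  forall (Z : bobj C2) (f : X -> Z), @is_mor C1 X (as_cat1 Hlc Z) f ->
    exists T : FX -> Z,
      [/\ is_bmor T, (forall x, T (delta x) = f x),
          lipnorm (@normdist FX) (@normdist Z) T = lipnorm (mdist X) (@normdist Z) f &
          forall S : FX -> Z, is_bmor S -> (forall x, S (delta x) = f x) -> S = T].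

(** [p : W -> Z -> R] identifies [W] with the dual [Z^*]: [w |-> p w .] is a
    linear isometry from [W] onto the space of bounded linear functionals on
    [Z] (with the dual norm). *)
Definition dual_pairing (W Z : completeNormedModType RR) (p : W -> Z -> RR) :=
  [/\ forall w, forall (a : RR) (x y : Z), p w (a *: x + y) = a * p w x + p w y,
      forall z, forall (a : RR) (u v : W), p (a *: u + v) z = a * p u z + p v z,
      forall w, `|w| = sup [set `|p w z| | z in [set z : Z | `|z| <= 1]] &
      forall phi : Z -> RR,
        (forall (a : RR) (x y : Z), phi (a *: x + y) = a * phi x + phi y) ->
        continuous phi -> exists w, forall z, p w z = phi z].

Definition bidual_of (Z D B : completeNormedModType RR) (p1 : D -> Z -> RR)
  (p2 : B -> D -> RR) (j : Z -> B) :=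
  [/\ dual_pairing p1, dual_pairing p2 & forall z d, p2 (j z) d = p1 d z].

Definition closed_under_biduals (C2 : bcat) :=
  forall (Z : bobj C2) (D B : completeNormedModType RR) (p1 : D -> Z -> RR)
         (p2 : B -> D -> RR) (j : Z -> B),
    bidual_of p1 p2 j ->
    exists (o : opsT (b_sig C2) B) (Ho : @b_ax C2 B o), @is_bmor C2 Z (BObj Ho) j.

Definition span_of (W : completeNormedModType RR) (n : nat) (v : 'I_n -> W) : set W :=
  [set \sum_(k < n) c k *: v k | c in [set: 'I_n -> RR]].

Definition locally_complemented (W : completeNormedModType RR) (Rg : set W) :=
  exists lam : RR, 1 <= lam /\
  forall (n : nat) (v : 'I_n -> W) (eps : RR), 0 < eps ->
    exists T : W -> W,
      [/\ forall (a : RR) x y, span_of v x -> span_of v y ->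
            T (a *: x + y) = a *: T x + T y,
          forall x, span_of v x -> Rg (T x),
          forall x, span_of v x -> Rg x -> T x = x &
          forall x, span_of v x -> `|T x| <= (lam + eps) * `|x|].

(** Isomorphic embedding (bounded below; boundedness/linearity are part of
    being a morphism). *)
Definition bounded_below (V W : completeNormedModType RR) (T : V -> W) :=
  exists c : RR, 0 < c /\ forall x, c * `|x| <= `|T x|.

(* Main.v *)
(** (2) => (3) => (4) follow from the universal property, and (1) => (2) by
    compactness: composing a map [N -> Z^*], linearized on [F[N]], with the local
    projections onto the range of [F[i]] gives uniformly bounded maps on the
    finite-dimensional subspaces of [F[M]], whose limit along an ultrafilter
    exists weak-* pointwise.

    (4) => (1) is a form of the principle of local reflexivity.  A
    finite-dimensional [V] in [F[M]] has finitely many unit vectors [u_g] such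
    that every [x] in [V] is [\sum_g a_g u_g] with [\sum_g |a_g| <= 3 |x|], so an
    operator on [V] is bounded as soon as its values at the [u_g] are.  The
    vectors [T u_g] of [F[N]^**] are replaced by vectors [zeta_g] of [F[N]] of
    almost the same norm, keeping every relation [\sum_g a_g T u_g = j z]: this
    is Helly's theorem, a consequence of the Mazur-Orlicz theorem on linear
    functionals between a sublinear functional and a convex cone. *)

Require Import Defs.
From HB Require Import structures.
From mathcomp Require Import all_boot all_order all_algebra.
From mathcomp Require Import all_classical all_reals all_analysis.
From mathcomp Require Import Rstruct Rstruct_topology.
From mathcomp Require Import lra.
Set Implicit Arguments.
Unset Strict Implicit.
Unset Printing Implicit Defensive.

Import Order.TTheory GRing.Theory Num.Theory.
Import numFieldNormedType.Exports.
Local Open Scope classical_set_scope.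
Local Open Scope ring_scope.

(** * The Mazur-Orlicz theorem *)

Definition sublinear (R : realType) (V : lmodType R) (p : V -> R) :=
  (forall x y, p (x + y) <= p x + p y) /\
  (forall a x, 0 <= a -> p (a *: x) <= a * p x).

(** A pair [(x, r)] in [K] encodes the constraint [r <= phi x] on the functional [phi] sought. *)
Definition convex_cone (R : realType) (V : lmodType R) (K : set (V * R)) :=
  [/\ K (0, 0), (forall k l, K k -> K l -> K (k.1 + l.1, k.2 + l.2)) &
      forall a k, 0 <= a -> K k -> K (a *: k.1, a * k.2)].

Section mazur_orlicz.
Context {R : realType} {V : lmodType R}.
Implicit Types (p q : V -> R) (K : set (V * R)).

Lemma sublinear0 p : sublinear p -> p 0 = 0.
Proof.
move=> [pD pZ]; apply/eqP; rewrite eq_le; apply/andP; split.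
  by have := pZ 0 0 (lexx _); rewrite scale0r mul0r.
by have := pD 0 0; rewrite addr0 lerDl.
Qed.

Lemma sublinear_geN p x : sublinear p -> - p (- x) <= p x.
Proof.
move=> sp; have := (sp.1 x (- x)).
rewrite subrr (sublinear0 sp) => ?; lra.
Qed.

(** The infimum of [p (x + k.1) - k.2] over [K] is finite because [k.2 <= p k.1]. A linear
    functional below it lies below [p] and meets every constraint in [K], so the cone can then be
    forgotten. *)
Lemma sublinear_cone_inf p K : sublinear p -> convex_cone K ->
  (forall k, K k -> k.2 <= p k.1) ->
  exists q, [/\ sublinear q, forall x, q x <= p x &
                forall k, K k -> q (- k.1) <= - k.2].
Proof.
move=> sp [K0 KD KZ] Kp.
pose E x := [set p (x + k.1) - k.2 | k in K].
have Elb x : lbound (E x) (- p (- x)).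
  move=> _ [k Kk <-]; have := sp.1 (x + k.1) (- x); rewrite addrC addKr.
  by have := Kp _ Kk => ? ?; lra.
have E0 x : E x !=set0 by exists (p (x + 0) - 0); exists (0, 0).
have Eh x : has_inf (E x) by split=> //; exists (- p (- x)).
have qle x k : K k -> inf (E x) <= p (x + k.1) - k.2.
  by move=> Kk; apply: ge_inf; [exact: (Eh x).2|exists k].
exists (fun x => inf (E x)); split; last 2 first.
- by move=> x; have := qle x _ K0; rewrite /= addr0 subr0.
- by move=> k Kk; have := qle (- k.1) _ Kk; rewrite addNr (sublinear0 sp) sub0r.
split=> [x y|a x].
  have key k l : K k -> K l ->
      inf (E (x + y)) <= (p (x + k.1) - k.2) + (p (y + l.1) - l.2).
    move=> Kk Kl; apply: le_trans (qle _ _ (KD _ _ Kk Kl)) _ => /=.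
    by have := sp.1 (x + k.1) (y + l.1); rewrite addrACA => ?; lra.
  rewrite -lerBlDr; apply: lb_le_inf => // _ [k Kk <-].
  rewrite lerBlDr -lerBlDl; apply: lb_le_inf => // _ [l Kl <-].
  by rewrite lerBlDl; exact: key.
rewrite le_eqVlt => /predU1P[<-|a0].
  rewrite scale0r mul0r; have := qle 0 _ K0.
  by rewrite /= addr0 subr0 (sublinear0 sp).
rewrite mulrC -ler_pdivrMr//; apply: lb_le_inf => // _ [k Kk <-].
rewrite ler_pdivrMr//; apply: le_trans (qle _ _ (KZ _ _ (ltW a0) Kk)) _ => /=.
by have := sp.2 a (x + k.1) (ltW a0); rewrite scalerDr => ?; lra.
Qed.

(** Zorn's lemma for the reversed pointwise order. A nonempty chain is bounded by its pointwise
    infimum, which is finite since every sublinear [s] below [p] satisfies [- p (- x) <= s x]. *)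
Lemma sublinear_minimal p : sublinear p ->
  exists q, [/\ sublinear q, forall x, q x <= p x &
    forall s, sublinear s -> (forall x, s x <= q x) -> forall x, q x <= s x].
Proof.
move=> sp; pose T := {q : V -> R | sublinear q /\ forall x, q x <= p x}.
pose t0 : T := exist _ p (conj sp (fun x => lexx _)).
pose le (s t : T) := `[< forall x, sval t x <= sval s x >].
suff [[q [sq qp]] qmin] : exists t, premaximal le t.
  exists q; split=> // s ss sq'.
  have sp' x : s x <= p x by exact: le_trans (sq' x) (qp x).
  by have /(_ (asboolT sq'))/asboolP := qmin (exist _ s (conj ss sp')).
apply: (ZL_preorder t0) => [t|r s t /asboolP rs /asboolP st|A Atot].
- exact/asboolP.
- by apply/asboolP => x; exact: le_trans (st x) (rs x).
have [->|/set0P[a Aa]] := eqVneq A set0; first by exists t0.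
pose E x := [set sval s x | s in A].
have E0 x : E x !=set0 by exists (sval a x); exists a.
have Eh x : has_inf (E x).
  split=> //; exists (- p (- x)) => _ [[s [ss sp']] As <-] /=.
  by apply: le_trans (sublinear_geN x ss); rewrite lerN2.
have Ele s x : A s -> inf (E x) <= sval s x.
  by move=> As; apply: ge_inf; [exact: (Eh x).2|exists s].
have sE : sublinear (fun x => inf (E x)).
  split=> [x y|c x c0].
    (* The infimum is subadditive because [A] is a chain: the smaller of [s] and [t], evaluated at
       [x + y], is at most [s x + t y]. *)
    have key s t : A s -> A t -> inf (E (x + y)) <= sval s x + sval t y.
      move=> As At; have [/asboolP st|/asboolP ts] := Atot _ _ As At.
        apply: le_trans (Ele t _ At) _; apply: le_trans ((svalP t).1.1 _ _) _.
        by rewrite lerD2r.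
      apply: le_trans (Ele s _ As) _; apply: le_trans ((svalP s).1.1 _ _) _.
      by rewrite lerD2l.
    rewrite -lerBlDr; apply: lb_le_inf => // _ [k Kk <-].
    rewrite lerBlDr -lerBlDl; apply: lb_le_inf => // _ [l Kl <-].
    by rewrite lerBlDl; exact: key.
  move: c0; rewrite le_eqVlt => /predU1P[<-|c0].
    apply: le_trans (Ele a _ Aa) _; apply: le_trans ((svalP a).1.2 _ _ _) _ => //.
    by rewrite !mul0r.
  rewrite mulrC -ler_pdivrMr//; apply: lb_le_inf => // _ [s As <-].
  rewrite ler_pdivrMr// mulrC; apply: le_trans (Ele s _ As) _.
  exact: (svalP s).1.2 (ltW c0).
have Ep x : inf (E x) <= p x by exact: le_trans (Ele a x Aa) ((svalP a).2 x).
pose t : T := exist _ (fun x => inf (E x)) (conj sE Ep).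
exists t => s As; apply/asboolP => x /=; exact: Ele.
Qed.

(* A minimal sublinear functional is linear, as passing to [inf_t q (x + t y) -
   t (q y)] cannot decrease it. *)
Lemma sublinear_dominates_linear p : sublinear p ->
  exists phi : V -> R, (forall a x y, phi (a *: x + y) = a * phi x + phi y) /\
    forall x, phi x <= p x.
Proof.
move=> /sublinear_minimal[q [sq qp qmin]]; exists q; split=> //.
have qN y : q (- y) = - q y.
  apply/eqP; rewrite eq_le; apply/andP; split; last first.
    by have := sublinear_geN (- y) sq; rewrite opprK.
  pose K := [set (t *: y, t * q y) | t in [set t : R | 0 <= t]].
  have cK : convex_cone K.
    split=> [|_ _ [s /= s0 <-] [t /= t0 <-]|a _ a0 [t /= t0 <-]] /=.
    - by exists 0 => /=; rewrite ?lexx// scale0r mul0r.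
    - by exists (s + t); rewrite /= ?addr_ge0// scalerDl mulrDl.
    - by exists (a * t); rewrite /= ?mulr_ge0// scalerA mulrA.
  have Kq k : K k -> k.2 <= q k.1.
    move=> [t /= + <-] /=; rewrite le_eqVlt => /predU1P[<-|t0].
      by rewrite scale0r mul0r (sublinear0 sq).
    have := sq.2 t^-1 (t *: y); rewrite invr_ge0 (ltW t0) => /(_ isT).
    by rewrite scalerK ?gt_eqF// ler_pdivlMl.
  have [s [ss sq' sK]] := sublinear_cone_inf sq cK Kq.
  apply: le_trans (qmin _ ss sq' _) _.
  by have := sK (y, q y); apply; exists 1; rewrite /= ?ler01// scale1r mul1r.
have qD x y : q (x + y) = q x + q y.
  apply/eqP; rewrite eq_le sq.1/=.
  by have := sq.1 (x + y) (- y); rewrite addrK qN => ?; lra.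
have qZ a x : 0 <= a -> q (a *: x) = a * q x.
  move=> a0; apply/eqP; rewrite eq_le sq.2//=.
  have := sq.2 a (- x) a0; rewrite scalerN !qN => ?; lra.
move=> a x y; rewrite qD; congr +%R.
have [/qZ//|a0] := leP 0 a.
by rewrite -[in LHS](opprK a) scaleNr qN qZ ?oppr_ge0 ?ltW// mulNr opprK.
Qed.

Lemma mazur_orlicz p K : sublinear p -> convex_cone K ->
  (forall k, K k -> k.2 <= p k.1) ->
  exists phi : V -> R, [/\ forall a x y, phi (a *: x + y) = a * phi x + phi y,
    forall x, phi x <= p x & forall k, K k -> k.2 <= phi k.1].
Proof.
move=> sp cK Kp; have [q [sq qp qK]] := sublinear_cone_inf sp cK Kp.
have [phi [lphi phiq]] := sublinear_dominates_linear sq.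
exists phi; split=> // [x|k Kk]; first exact: le_trans (phiq x) (qp x).
have := le_trans (phiq _) (qK _ Kk).
have phi0 : phi 0 = 0.
  by have := lphi 1 0 0; rewrite scaler0 addr0 mul1r => ?; lra.
by have := lphi (-1) k.1 0; rewrite scaleN1r !addr0 phi0 addr0 mulN1r => ->;
  rewrite lerN2.
Qed.

End mazur_orlicz.

(** * Duals and biduals *)

Section linear_maps.
Context {R : nzRingType} {U V : lmodType R} {f : U -> V}.
Hypothesis lf : forall a x y, f (a *: x + y) = a *: f x + f y.

Lemma lin0 : f 0 = 0.
Proof.
have := lf 1 0 0; rewrite !scale1r addr0 => /esym/eqP.
by rewrite -subr_eq0 addrK => /eqP.
Qed.

Lemma linD x y : f (x + y) = f x + f y.
Proof. by have := lf 1 x y; rewrite !scale1r. Qed.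

Lemma linZ a x : f (a *: x) = a *: f x.
Proof. by have := lf a x 0; rewrite lin0 !addr0. Qed.

Lemma linN x : f (- x) = - f x.
Proof. by rewrite -scaleN1r linZ scaleN1r. Qed.

Lemma linB x y : f (x - y) = f x - f y.
Proof. by rewrite linD linN. Qed.

Lemma lin_sum (I : Type) (r : seq I) (P : pred I) (x : I -> U) :
  f (\sum_(i <- r | P i) x i) = \sum_(i <- r | P i) f (x i).
Proof. exact: (big_morph f linD lin0). Qed.

End linear_maps.

Lemma normr_lipschitz (V W : completeNormedModType RR) (T : V -> W) :
  is_linear T -> Defs.lipschitz (@normdist V) (@normdist W) T ->
  exists L, 0 <= L /\ forall x, `|T x| <= L * `|x|.
Proof.
move=> lT [L [L0 TL]]; exists L; split=> // x.
by have := TL x 0; rewrite /normdist (lin0 lT) !subr0.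
Qed.

Lemma lipschitz_normr (V W : completeNormedModType RR) (T : V -> W) L :
  is_linear T -> 0 <= L -> (forall x, `|T x| <= L * `|x|) ->
  Defs.lipschitz (@normdist V) (@normdist W) T.
Proof.
by move=> lT L0 TL; exists L; split=> // x y; rewrite /normdist -(linB lT).
Qed.

Section dual_pairing.
Context {W Z : completeNormedModType RR} {p : W -> Z -> RR}.
Hypothesis pP : dual_pairing p.

Let plin w : forall a x y, p w (a *: x + y) = a *: (p w x : RR^o) + p w y.
Proof. by case: pP => + _ _ _; exact. Qed.

Let plinl z : forall a u v, p (a *: u + v) z = a *: (p u z : RR^o) + p v z.
Proof. by case: pP => _ + _ _; exact. Qed.

Lemma dual_sumr w (I : finType) (z : I -> Z) :
  p w (\sum_i z i) = \sum_i p w (z i).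
Proof. exact: (lin_sum (V := RR^o) (plin w)). Qed.

Lemma dual_suml z (I : finType) (w : I -> W) :
  p (\sum_i w i) z = \sum_i p (w i) z.
Proof. exact: (lin_sum (V := RR^o) (f := p^~ z) (plinl z)). Qed.

Lemma dualZr w a z : p w (a *: z) = a * p w z.
Proof. exact: (linZ (V := RR^o) (plin w)). Qed.

Lemma dualZl w a z : p (a *: w) z = a * p w z.
Proof. exact: (linZ (V := RR^o) (f := p^~ z) (plinl z)). Qed.

(* [sup] of an unbounded set is [0], so the norm formula in [dual_pairing] only
   gives the boundedness of [p w] together with the linearity in [w]. *)
Lemma dual_le w z : `|p w z| <= `|w| * `|z|.
Proof.
pose E := [set `|p w z| | z in [set z : Z | `|z| <= 1]].
have wE : `|w| = sup E by case: pP.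
have E0 : E !=set0 by exists `|p w 0|; exists 0; rewrite //= normr0.
have [Eb|Eb] := pselect (has_ubound E); last first.
  have w0 : w = 0.
    by apply/eqP; rewrite -normr_eq0 wE sup_out// => -[].
  by rewrite w0 (lin0 (V := RR^o) (f := p^~ z) (plinl z)) !normr0 mul0r.
have [->|z0] := eqVneq z 0.
  by rewrite (lin0 (V := RR^o) (plin w)) !normr0 mulr0.
have nz : 0 < `|z| by rewrite normr_gt0.
rewrite -ler_pdivrMr// wE; apply: ub_le_sup => //.
exists (`|z|^-1 *: z) => /=.
  by rewrite normrZ gtr0_norm ?invr_gt0// mulVf// gt_eqF.
by rewrite dualZr normrM gtr0_norm ?invr_gt0// mulrC.
Qed.

Lemma dual_norm_le w c : 0 <= c -> (forall z, `|p w z| <= c * `|z|) -> `|w| <= c.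
Proof.
move=> c0 wc; case: pP => _ _ -> _; apply: ge_sup.
  by exists `|p w 0|; exists 0; rewrite //= normr0.
move=> _ [z /= z1 <-]; apply: le_trans (wc z) _.
by rewrite ler_piMr.
Qed.

Lemma dual_norm_approx w e : 0 < e -> exists z, `|z| <= 1 /\ `|w| - e < p w z.
Proof.
move=> e0; have [we|we] := ltP (`|w| - e) 0.
  exists 0; rewrite normr0 ler01; split=> //.
  by rewrite (lin0 (V := RR^o) (plin w)).
have : `|w| - e < `|w| by rewrite gtrBl.
have [_ _ {2}-> _] := pP.
move=> /sup_gt[|_ [z /= z1 <-] wz].
  by exists `|p w 0|; exists 0; rewrite //= normr0.
(* The supremum runs over absolute values; a negative value is corrected by passing to [- z]. *)
have [pz|pz] := ltP 0 (p w z).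
  by exists z; split=> //; rewrite -[ltRHS]gtr0_norm.
exists (- z); rewrite normrN; split=> //.
by rewrite (linN (V := RR^o) (plin w)) -(ler0_norm pz).
Qed.

Lemma dual_inj u v : (forall z, p u z = p v z) -> u = v.
Proof.
move=> uv; apply/eqP; rewrite -subr_eq0 -normr_le0; apply: dual_norm_le => // z.
by rewrite (linB (V := RR^o) (f := p^~ z) (plinl z)) uv subrr normr0 mul0r.
Qed.

Lemma dual_repr (phi : Z -> RR) c :
  (forall (a : RR) (x y : Z), phi (a *: x + y) = a * phi x + phi y) ->
  (forall z, `|phi z| <= c * `|z|) -> exists w, forall z, p w z = phi z.
Proof.
move=> lphi bphi; case: pP => _ _ _; apply=> //.
move=> x; apply/(@cvgrPdist_lt _ RR^o) => e e0; near=> y.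
have -> : phi x - phi y = phi (x - y).
  by rewrite (linB (V := RR^o) lphi).
(* No sign is assumed for [c], so [|c| + 1] serves as a positive bound. *)
have c0 : 0 < `|c| + 1 by rewrite ltr_wpDl.
apply: le_lt_trans (bphi _) _.
have : `|x - y| < e / (`|c| + 1).
  by near: y; apply: cvgr_dist_lt => //; rewrite divr_gt0.
rewrite ltr_pdivlMr// => /(le_lt_trans _); apply.
rewrite mulrC ler_wpM2l//; have := ler_norm c; lra.
Unshelve. all: by end_near. Qed.

End dual_pairing.

(** Hahn-Banach: Mazur-Orlicz on the ray through [(x, |x|)] gives a functional of norm at most 1
    whose value at [x] is at least [|x|]; [j x] is evaluated at it. *)
Lemma bidual_isometry (Z D B : completeNormedModType RR) (p1 : D -> Z -> RR)
    (p2 : B -> D -> RR) (j : Z -> B) (x : Z) :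
  bidual_of p1 p2 j -> `|x| <= `|j x|.
Proof.
move=> [p1P p2P jP].
pose K := [set (t *: x, t * `|x|) | t in [set t : RR | 0 <= t]].
have [||_ [t /= t0 <-] /=|phi [lphi phin phiK]] :=
  @mazur_orlicz _ Z (fun z => `|z|) K.
- split=> [y z|a y a0]; first exact: ler_normD.
  by rewrite normrZ ger0_norm.
- split=> [|_ _ [s /= s0 <-] [t /= t0 <-]|a _ a0 [t /= t0 <-]] /=.
  + by exists 0 => /=; rewrite ?lexx// scale0r mul0r.
  + by exists (s + t); rewrite /= ?addr_ge0// scalerDl mulrDl.
  + by exists (a * t); rewrite /= ?mulr_ge0// scalerA mulrA.
- by rewrite normrZ ger0_norm.
have phib z : `|phi z| <= 1 * `|z|.
  rewrite mul1r ler_norml phin andbT lerNl -(linN (V := RR^o) lphi).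
  by rewrite -[leRHS]normrN.
have [d dphi] := dual_repr p1P lphi phib.
have d1 : `|d| <= 1.
  by apply: (dual_norm_le p1P) => // z; rewrite dphi.
have : `|x| <= phi x.
  by have /= := phiK (x, `|x|); apply; exists 1; rewrite /= ?ler01// scale1r mul1r.
move=> /le_trans; apply; rewrite -dphi -jP.
apply: le_trans (ler_norm _) _; apply: le_trans (dual_le p2P _ _) _.
by rewrite ler_piMr.
Qed.

(** [V] is a bare set, so a matrix [A] of maximal rank with row space inside [V] is taken. A vector
    of [V] outside the row space would raise the rank, hence the row space is [V] and
    [pinvmx A *m A] projects onto it. *)
Lemma subspace_projection (F : fieldType) m (V : set 'rV[F]_m) :
  V 0 -> (forall c a b, V a -> V b -> V (c *: a + b)) ->
  exists P : 'M[F]_m, (forall a, V (a *m P)) /\ (forall a, V a -> a *m P = a).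
Proof.
move=> V0 Vlin.
pose Q r := `[< exists A : 'M[F]_m, (forall a : 'rV_m, (a <= A)%MS -> V a) /\
                                   \rank A = r >].
have Q0 : exists r, Q r.
  exists 0%N; apply/asboolP; exists 0; rewrite mxrank0; split=> // a.
  by rewrite submx0 => /eqP ->.
have Qm r : Q r -> (r <= m)%N by move=> /asboolP[A [_ <-]]; exact: rank_leq_row.
case: (ex_maxnP Q0 Qm) => r /asboolP[A [AV rA]] rmax.
have VA (a : 'rV_m) : V a -> (a <= A)%MS.
  move=> Va; apply: contrapT => /negP aA.
  have : (\rank A < \rank (A + a)%MS)%N.
    apply: rank_ltmx; rewrite ltmxE addsmxSl/=.
    by apply: contra aA; apply: submx_trans; exact: addsmxSr.
  rewrite rA ltnNge rmax//; apply/asboolP; exists (A + a)%MS; split=> // b.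
  move=> /sub_addsmxP[[u v] /= ->].
  rewrite addrC [v]mx11_scalar mul_scalar_mx; apply: Vlin => //.
  by apply: AV; exact: submxMl.
exists (pinvmx A *m A); split=> a; rewrite mulmxA.
  by apply: AV; exact: submxMl.
by move=> /VA; exact: mulmxKpV.
Qed.

Lemma bidual_linear (Z D B : completeNormedModType RR) (p1 : D -> Z -> RR)
    (p2 : B -> D -> RR) (j : Z -> B) : bidual_of p1 p2 j -> is_linear j.
Proof.
move=> [p1P p2P jP] a x y; apply: (dual_inj p2P) => d.
have [_ -> _ _] := p2P; have [+ _ _ _] := p1P.
by rewrite !jP; exact.
Qed.

Lemma bidual_inj (Z D B : completeNormedModType RR) (p1 : D -> Z -> RR)
    (p2 : B -> D -> RR) (j : Z -> B) : bidual_of p1 p2 j -> injective j.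
Proof.
move=> bd x y jxy; apply/eqP; rewrite -subr_eq0 -normr_le0.
apply: le_trans (bidual_isometry (x - y) bd) _.
by rewrite (linB (bidual_linear bd)) jxy subrr normr0.
Qed.

(** * Helly's theorem for the bidual *)

Section max_norm.
Context {Z : completeNormedModType RR} {m : nat}.
Implicit Types z : {ffun 'I_m -> Z}.

(** A linear functional below this norm is a family of functionals on [Z] whose norms sum to at most
    1. *)
Definition max_norm z : RR := \big[Num.max/0]_g `|z g|.

Lemma max_norm_ge0 z : 0 <= max_norm z.
Proof. exact: bigmax_ge_id. Qed.

Lemma le_max_norm z g : `|z g| <= max_norm z.
Proof. exact: (@le_bigmax _ _ _ 0 (fun g => `|z g|)). Qed.

Lemma max_norm_le z c : 0 <= c -> (forall g, `|z g| <= c) -> max_norm z <= c.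
Proof. by move=> c0 zc; apply: bigmax_le => // g _; exact: zc. Qed.

Lemma max_norm_sublinear : sublinear max_norm.
Proof.
split=> [y z|a z a0]; apply: max_norm_le.
- by rewrite addr_ge0 ?max_norm_ge0.
- by move=> g; rewrite ffunE (le_trans (ler_normD _ _))// lerD ?le_max_norm.
- by rewrite mulr_ge0 ?max_norm_ge0.
- by move=> g; rewrite ffunE normrZ ger0_norm// ler_wpM2l ?le_max_norm.
Qed.

End max_norm.

(* If no [zeta] existed, Mazur-Orlicz would give functionals [d_g] with
   [\sum_g `|d_g| <= 1] and [\sum_g w_g (d_g) >= C + e]. *)
Lemma bidual_helly (Z D B : completeNormedModType RR) (p1 : D -> Z -> RR)
    (p2 : B -> D -> RR) (j : Z -> B) m (w : 'I_m -> B) (C e : RR) :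
  bidual_of p1 p2 j -> 0 <= C -> 0 < e -> (forall g, `|w g| <= C) ->
  exists zeta : 'I_m -> Z, (forall g, `|zeta g| <= C + e) /\
    forall (a : 'I_m -> RR) z,
      \sum_g a g *: w g = j z -> \sum_g a g *: zeta g = z.
Proof.
move=> bd C0 e0 wC; have [p1P p2P jP] := bd.
have lj := bidual_linear bd; have injj := bidual_inj bd.
(* [V] collects the coefficient rows of the relations that [zeta] has to preserve; [P] projects onto
   it. *)
pose V := [set a : 'rV[RR]_m | exists z, \sum_g a 0 g *: w g = j z].
have [||P [PV VP]] := @subspace_projection _ _ V.
- exists 0; rewrite (lin0 lj) big1// => g _; by rewrite mxE scale0r.
- move=> c a b [x ax] [y bx]; exists (c *: x + y); rewrite lj -ax -bx.
  rewrite scaler_sumr -big_split; apply: eq_bigr => g _.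
  by rewrite !mxE scalerDl scalerA.
have PE a (E : lmodType RR) (x : 'I_m -> E) : V a ->
    \sum_g a 0 g *: \sum_h P g h *: x h = \sum_g a 0 g *: x g.
  move=> Va; rewrite -[in RHS](VP a Va).
  under eq_bigr do rewrite scaler_sumr.
  rewrite exchange_big; apply: eq_bigr => h _.
  by rewrite mxE scaler_suml; apply: eq_bigr => g _; rewrite scalerA.
(* The rows of [P] lie in [V]. The resulting [Y] satisfies all the relations, but with no control on
   its norm. *)
have /choice[Y YP] g : exists z, \sum_h P g h *: w h = j z.
  have [z zP] := PV (delta_mx 0 g); exists z; rewrite -zP.
  by apply: eq_bigr => h _; rewrite -rowE mxE.
apply: contrapT => nzeta.
(* At [t = 1] the cone demands [phi >= C + e] at every family satisfying the relations. At [t = 0]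
   it contains the solutions of the homogeneous relations with both signs, so [phi] vanishes
   there. *)
pose K := [set k : {ffun 'I_m -> Z} * RR | exists2 t : RR, 0 <= t &
   k.2 = t * (C + e) /\ forall (a : 'rV[RR]_m) z, \sum_g a 0 g *: w g = j z ->
     \sum_g a 0 g *: k.1 g = t *: z].
have cK : convex_cone K.
  split=> [|k l [s s0 [ks kP]] [t t0 [lt lP]]|c k c0 [t t0 [kt kP]]].
  - exists 0 => //=; rewrite mul0r; split=> // a z _.
    by rewrite scale0r big1// => g _; rewrite ffunE scaler0.
  - exists (s + t) => /=; first exact: addr_ge0.
    split=> [|a z az]; first by rewrite ks lt mulrDl.
    rewrite scalerDl -(kP a z)// -(lP a z)// -big_split; apply: eq_bigr => g _.
    by rewrite ffunE scalerDr.
  - exists (c * t) => /=; first exact: mulr_ge0.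
    split=> [|a z az]; first by rewrite kt mulrA.
    rewrite -scalerA -(kP a z)// scaler_sumr; apply: eq_bigr => g _.
    by rewrite ffunE !scalerA mulrC.
(* A violation with [t > 0] would make [t^-1 *: k.1] a family of the kind assumed not to exist. *)
have Kp k : K k -> k.2 <= max_norm k.1.
  move=> [t + [-> kP]]; rewrite le_eqVlt => /predU1P[<-|t0].
    by rewrite mul0r max_norm_ge0.
  rewrite leNgt; apply/negP => kC; apply: nzeta.
  exists (fun g => t^-1 *: k.1 g); split=> [g|a z az].
    rewrite normrZ gtr0_norm ?invr_gt0// ler_pdivrMl//.
    exact: le_trans (le_max_norm _ _) (ltW kC).
  have aE (E : lmodType RR) (x : 'I_m -> E) :
      \sum_g (\row_h a h) 0 g *: x g = \sum_g a g *: x g.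
    by apply: eq_bigr => g _; rewrite mxE.
  have := kP (\row_h a h) z; rewrite !aE => /(_ az) kz.
  rewrite -[RHS](scalerK (lt0r_neq0 t0)) -kz scaler_sumr.
  by apply: eq_bigr => g _; rewrite !scalerA mulrC.
have [phi [lphi phip phiK]] := mazur_orlicz max_norm_sublinear cK Kp.
pose inj (h : 'I_m) (z : Z) : {ffun 'I_m -> Z} :=
  [ffun g => if g == h then z else 0].
have sum_inj (z : {ffun 'I_m -> Z}) : z = \sum_h inj h (z h).
  apply/ffunP => g; rewrite sum_ffunE (bigD1 g)//= ffunE eqxx big1 ?addr0// => h.
  by rewrite ffunE eq_sym => /negPf ->.
have phi_ker (k : {ffun 'I_m -> Z}) :
    (forall (a : 'rV[RR]_m) z, \sum_g a 0 g *: w g = j z ->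
      \sum_g a 0 g *: k g = 0) ->
    phi k = 0.
  move=> kP; apply/eqP; rewrite eq_le; apply/andP; split.
    have := phiK (- k, 0); rewrite /= (linN (V := RR^o) lphi) oppr_ge0; apply.
    exists 0 => //=; rewrite mul0r; split=> // a z /kP ak.
    rewrite scale0r; under eq_bigr do rewrite ffunE scalerN.
    by rewrite sumrN ak oppr0.
  have := phiK (k, 0); apply; exists 0 => //=; rewrite mul0r; split=> // a z /kP.
  by rewrite scale0r.
have /choice[d dP] h : exists d, forall z, p1 d z = phi (inj h z).
  apply: (dual_repr p1P (c := 1)) => [a x y|z].
    rewrite -lphi; congr phi; apply/ffunP => g; rewrite !ffunE.
    by case: ifP => //; rewrite scaler0 addr0.
  have injz z' : max_norm (inj h z') <= `|z'|.
    by apply: max_norm_le => // g; rewrite ffunE; case: ifP; rewrite ?normr0.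
  rewrite mul1r ler_norml (le_trans (phip _) (injz z)) andbT.
  rewrite lerNl -(linN (V := RR^o) lphi).
  have -> : - inj h z = inj h (- z).
    by apply/ffunP => g; rewrite !ffunE; case: ifP; rewrite ?oppr0.
  by rewrite (le_trans (phip _))// (le_trans (injz _))// normrN.
have phiE (z : {ffun 'I_m -> Z}) : phi z = \sum_g p1 (d g) (z g).
  rewrite {1}(sum_inj z) (lin_sum (V := RR^o) lphi).
  by apply: eq_bigr => g _; rewrite dP.
(* [inj h z] and the family [P g h *: z] have the same sums against every row in [V], as
   [a *m P = a] there, so [phi] does not separate them. *)
have dE h : d h = \sum_g P g h *: d g.
  apply: (dual_inj p1P) => z; rewrite (dual_suml p1P) dP.
  have -> : phi (inj h z) = phi [ffun g => P g h *: z].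
    apply/eqP; rewrite -subr_eq0 -(linB (V := RR^o) lphi); apply/eqP/phi_ker.
    move=> a y ay; have Va : V a by exists y.
    under eq_bigr do rewrite !ffunE scalerBr.
    rewrite sumrB; apply/eqP; rewrite subr_eq0; apply/eqP.
    have := PE a Z (inj h z) Va; under [in RHS]eq_bigr do rewrite ffunE.
    move=> <-; apply: eq_bigr => g _; congr (_ *: _).
    rewrite (bigD1 h)//= ffunE eqxx big1 ?addr0// => i /negPf ih.
    by rewrite ffunE ih scaler0.
  rewrite phiE; apply: eq_bigr => g _.
  by rewrite ffunE (dualZr p1P) (dualZl p1P).
have phiY : C + e <= phi [ffun g => Y g].
  apply: (phiK (_, C + e)); exists 1 => //=; rewrite mul1r; split=> // a z az.
  rewrite scale1r; apply: injj; rewrite (lin_sum lj) -az.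
  have Va : V a by exists z.
  rewrite -(PE a B w Va); apply: eq_bigr => g _.
  by rewrite (linZ lj) ffunE YP.
(* Each [d g] is nearly normed by some [z g] in the unit ball, and [phi] is at most 1 at the family
   [z]. The [m] errors [eta / (m + 1)] add up to at most [eta], also when [m = 0]. *)
have d1 : \sum_g `|d g| <= 1.
  apply/ler_addgt0Pr => eta eta0.
  have m0 : 0 < m%:R + 1 :> RR by rewrite ltr_wpDl.
  have /choice[z zP] g : exists z, `|z| <= 1 /\ `|d g| - eta / (m%:R + 1) < p1 (d g) z.
    by apply: (dual_norm_approx p1P); rewrite divr_gt0.
  have : phi [ffun g => z g] <= 1.
    apply: le_trans (phip _) _; apply: max_norm_le => // g.
    by rewrite ffunE; exact: (zP g).1.
  have : \sum_g (`|d g| - eta / (m%:R + 1)) <= phi [ffun g => z g].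
    rewrite phiE; apply: ler_sum => g _; rewrite ffunE; exact: ltW (zP g).2.
  rewrite sumrB sumr_const card_ord -[X in _ - X]mulr_natr => ds phi1.
  have : eta / (m%:R + 1) * m%:R <= eta.
    rewrite -mulrA ler_piMr ?(ltW eta0)// mulrC ler_pdivrMr//; lra.
  lra.
suff : phi [ffun g => Y g] <= C by move=> ?; lra.
(* By [YP] the sum of [p1 (d g) (Y g)] is a double sum of [P g h * p2 (w h) (d g)]; summing over [g]
   first restores [d h] by [dE]. *)
have -> : phi [ffun g => Y g] = \sum_h p2 (w h) (d h).
  rewrite phiE; under [RHS]eq_bigr => h _ do rewrite [in X in p2 _ X]dE (dual_sumr p2P).
  rewrite exchange_big; apply: eq_bigr => g _.
  rewrite ffunE -jP -YP (dual_suml p2P); apply: eq_bigr => h _.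
  by rewrite (dualZr p2P) (dualZl p2P).
apply: (@le_trans _ _ (\sum_h C * `|d h|)).
  apply: ler_sum => h _; apply: le_trans (ler_norm _) _.
  by apply: le_trans (dual_le p2P _ _) _; rewrite ler_wpM2r.
by rewrite -mulr_sumr ler_piMr.
Qed.

(** * Finite-dimensional subspaces *)

Lemma continuous_lincomb (W : completeNormedModType RR) n (v : 'I_n -> W) :
  continuous (fun c : 'rV[RR]_n => \sum_k c 0 k *: v k).
Proof.
suff cs s : continuous (fun c : 'rV[RR]_n => \sum_(k <- s) c 0 k *: v k).
  exact: cs.
elim: s => [|k s IHs].
  by under eq_fun do rewrite big_nil; exact: cst_continuous.
under eq_fun do rewrite big_cons.
move=> c.
have cc : {for c, continuous (fun c : 'rV[RR]_n => c 0 k *: v k)}.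
  by apply: continuousZ; [exact: coord_continuous|exact: cst_continuous].
exact: (continuousD cc (IHs c)).
Qed.

Lemma le_row_norm n (c : 'rV[RR]_n) k : `|c 0 k| <= `|c|.
Proof.
by rewrite [leRHS]mx_normrE; apply: (@le_bigmax _ _ _ 0
  (fun ij : 'I_1 * 'I_n => `|c ij.1 ij.2|) (0, k)).
Qed.

(** Dependent vectors are handled by dropping one of them. For independent ones the norm of the
    combination has a positive minimum on the compact unit sphere of coefficients, and its inverse
    is the bound. *)
Lemma span_coef_bound (W : completeNormedModType RR) n (v : 'I_n -> W) :
  exists K, 0 <= K /\ forall x, span_of v x ->
    exists c : 'I_n -> RR, x = \sum_k c k *: v k /\ forall k, `|c k| <= K * `|x|.
Proof.
elim: n v => [|n IHn] v.
  by exists 0; split=> // x [c _ <-]; exists c; split=> // -[].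
have [[c0 [c0N0 vc0]]|indep] := pselect (exists c : 'rV[RR]_n.+1,
    c != 0 /\ \sum_k c 0 k *: v k = 0).
  have [k0 ck0] : exists k0, c0 0 k0 != 0.
    apply: contrapT => ck; move/eqP: c0N0; apply; apply/rowP => k; rewrite mxE.
    by apply: contrapT => /eqP ?; apply: ck; exists k.
  have [K [K0 KP]] := IHn (v \o lift k0).
  exists K; split=> // x vx.
  have [] := KP x.
    have [c _ <-] := vx.
    (* The relation [c0] is used to eliminate [v k0]. *)
    pose b i := c (lift k0 i) - c k0 / c0 0 k0 * c0 0 (lift k0 i).
    exists b => //; under eq_bigr do rewrite scalerBl.
    rewrite sumrB [RHS](bigD1_ord k0)//= addrC; congr +%R.
    move: vc0; rewrite (bigD1_ord k0)//= => /eqP; rewrite addr_eq0 => /eqP vk0.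
    have -> : c k0 *: v k0 = (c k0 / c0 0 k0) *: (c0 0 k0 *: v k0).
      by rewrite scalerA divfK.
    rewrite vk0 scalerN scaler_sumr; congr (- _).
    by apply: eq_bigr => i _; rewrite scalerA.
  move=> b [xb bK].
  exists (fun k => if unlift k0 k is Some i then b i else 0); split.
    rewrite (bigD1_ord k0)//= unlift_none scale0r add0r xb.
    by apply: eq_bigr => i _; rewrite liftK.
  move=> k; case: unlift => [i|]; first exact: bK.
  by rewrite normr0 mulr_ge0.
pose f (c : 'rV[RR]_n.+1) := `|\sum_k c 0 k *: v k|.
have cf : continuous f.
  move=> c; apply: (@cvg_comp _ _ _ _ _ _ (nbhs (\sum_k c 0 k *: v k))).
    exact: continuous_lincomb.
  exact: norm_continuous.
pose S := [set c : 'rV[RR]_n.+1 | `|c| = 1].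
have nS (c : 'rV[RR]_n.+1) : c != 0 -> S (`|c|^-1 *: c).
  by move=> c0; rewrite /S /= normrZ normfV normr_id mulVf// normr_eq0.
have S0 : S !=set0.
  exists (`|const_mx 1 : 'rV[RR]_n.+1|^-1 *: const_mx 1); apply: nS.
  by apply/eqP => /rowP /(_ 0); rewrite !mxE => /eqP; rewrite oner_eq0.
have cS : compact S.
  apply: bounded_closed_compact.
    by exists 1; split=> // M M1 c /= ->; exact: ltW.
  apply: (@preimage_closed _ _ (fun c : 'rV[RR]_n.+1 => `|c|) [set 1]).
    by move=> c _; exact: norm_continuous.
  exact: closed_eq.
have [c1 /[!inE] Sc1 c1min] := EVT_min_rV S0 cS (continuous_subspaceT cf).
have f1 : 0 < f c1.
  rewrite normr_gt0; apply/eqP => vc1; apply: indep; exists c1; split=> //.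
  by rewrite -normr_eq0 Sc1 oner_eq0.
exists (f c1)^-1; split; first by rewrite invr_ge0 ltW.
move=> _ [c _ <-]; exists c; split=> // k.
rewrite ler_pdivlMl//; pose r := \row_k c k.
have rE : \sum_k r 0 k *: v k = \sum_k c k *: v k.
  by apply: eq_bigr => i _; rewrite mxE.
have [r0|r0] := eqVneq r 0.
  by have /rowP/(_ k) := r0; rewrite !mxE => ->; rewrite normr0 mulr0.
have nr : 0 < `|r| by rewrite normr_gt0.
have : f c1 <= f (`|r|^-1 *: r) by apply: c1min; rewrite inE; exact: nS.
have -> : f (`|r|^-1 *: r) = `|r|^-1 * `|\sum_k c k *: v k|.
  rewrite /f -rE -[X in _ = X * _]gtr0_norm ?invr_gt0// -normrZ scaler_sumr.
  by congr `|_|; apply: eq_bigr => i _; rewrite mxE scalerA.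
rewrite ler_pdivlMl//; apply: le_trans; rewrite mulrC.
by rewrite ler_wpM2r ?(ltW f1)//; have := le_row_norm r k; rewrite mxE.
Qed.

(* The [u g] are a grid in the ball of radius 2, shrunk to the unit ball,
   together with the normalized [v k] that absorb the rounding errors. *)
Lemma span_polytope (W : completeNormedModType RR) n (v : 'I_n -> W) :
  exists m (u : 'I_m -> W), (forall g, `|u g| <= 1) /\
    forall x, span_of v x ->
      exists a : 'I_m -> RR, x = \sum_g a g *: u g /\ \sum_g `|a g| <= 3 * `|x|.
Proof.
suff [I [u [u1 uP]]] : exists (I : finType) (u : I -> W), (forall g, `|u g| <= 1) /\
    forall x, span_of v x -> `|x| = 1 ->
      exists a : I -> RR, x = \sum_g a g *: u g /\ \sum_g `|a g| <= 3.
  exists #|I|, (u \o enum_val); split=> [g|x vx]; first exact: u1.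
  have [->|x0] := eqVneq x 0.
    exists (fun=> 0); split; first by rewrite big1// => g _; rewrite scale0r.
    by rewrite big1 => [|g _]; rewrite normr0 ?mulr0.
  have nx : 0 < `|x| by rewrite normr_gt0.
  have [||a [xa a3]] := uP (`|x|^-1 *: x).
  - have [c _ <-] := vx; exists (fun k => `|\sum_k c k *: v k|^-1 * c k) => //.
    by rewrite scaler_sumr; apply: eq_bigr => k _; rewrite scalerA.
  - by rewrite normrZ normfV normr_id mulVf// gt_eqF.
  exists (fun g => `|x| * a (enum_val g)); split.
    rewrite -[LHS](scalerKV (lt0r_neq0 nx)) xa scaler_sumr.
    rewrite (big_enum_val (fun g => `|x| *: (a g *: u g))).
    by apply: eq_bigr => g _; rewrite scalerA.
  under eq_bigr do rewrite normrM normr_id.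
  rewrite -mulr_sumr mulrC ler_pM2r//; apply: le_trans a3.
  by rewrite (big_enum_val (fun g => `|a g|)).
have [K [K0 KP]] := span_coef_bound v.
pose N := \sum_k `|v k|.
have N0 : 0 <= N by apply: sumr_ge0.
(* With this mesh, rounding every coefficient moves a vector by at most [e * N <= 1]. *)
pose e := (N + 1)^-1.
have e0 : 0 < e by rewrite invr_gt0 ltr_wpDl.
(* Coefficients of unit vectors lie in [[- K, K]], which [G + 1] grid points of step [e] cover when
   rounding down. *)
pose G := Num.truncn (2 * K / e).
pose y (t : {ffun 'I_n -> 'I_G.+1}) := \sum_k ((t k)%:R * e - K) *: v k.
pose nrm t := Num.max 1 `|y t|.
have nrm0 t : 0 < nrm t by rewrite lt_max ltr01.
pose u (g : {ffun 'I_n -> 'I_G.+1} + 'I_n) : W :=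
  match g with inl t => (nrm t)^-1 *: y t | inr k => `|v k|^-1 *: v k end.
exists ({ffun 'I_n -> 'I_G.+1} + 'I_n)%type, u; split=> [[t|k]|x vx x1] /=.
- rewrite normrZ gtr0_norm ?invr_gt0// mulrC ler_pdivrMr// mul1r.
  by rewrite le_max lexx orbT.
- have [->|vk] := eqVneq (v k) 0; first by rewrite scaler0 normr0 ler01.
  by rewrite normrZ normfV normr_id mulVf// normr_eq0.
have [c [xc cK]] := KP x vx.
have {}cK k : - K <= c k <= K by rewrite -ler_norml; have := cK k; rewrite x1 mulr1.
have ce0 k : 0 <= (c k + K) / e.
  by rewrite divr_ge0 ?(ltW e0)//; have := cK k => ?; lra.
have tG k : (Num.truncn ((c k + K) / e) < G.+1)%N.
  rewrite ltnS; apply: le_truncn; have ei0 : 0 < e^-1 by rewrite invr_gt0.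
  rewrite (ler_pM2r ei0).
  by have := cK k => ?; lra.
pose t := [ffun k => Ordinal (tG k)].
pose rho k := c k - ((t k)%:R * e - K).
have rho_itv k : 0 <= rho k <= e.
  have := truncn_itv (ce0 k); rewrite /rho ffunE /= ler_pdivlMr// ltr_pdivrMr//.
  by rewrite -natr1 => ?; lra.
have xy : x = y t + \sum_k rho k *: v k.
  rewrite xc /y -big_split; apply: eq_bigr => k _ /=.
  by rewrite -scalerDl addrC subrK.
have sum_rho : \sum_k rho k * `|v k| <= 1.
  apply: (@le_trans _ _ (\sum_k e * `|v k|)).
    by apply: ler_sum => k _; rewrite ler_wpM2r//; case/andP: (rho_itv k).
  by rewrite -mulr_sumr mulrC ler_pdivrMr ?ltr_wpDl// mul1r lerDl.
have nrm2 : nrm t <= 2.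
  rewrite ge_max ler1n/=.
  have -> : y t = x - \sum_k rho k *: v k by rewrite xy addrK.
  apply: le_trans (ler_normB _ _) _; rewrite x1.
  suff : `|\sum_k rho k *: v k| <= 1 by move=> ?; lra.
  apply: le_trans sum_rho; apply: le_trans (ler_norm_sum _ _ _) _.
  apply: ler_sum => k _; rewrite normrZ ger0_norm//.
  by case/andP: (rho_itv k).
(* The rounded point [y t] costs [nrm t <= 2] and the rounding errors cost at most 1, whence the
   constant 3. *)
exists (fun g => match g with inl s => if s == t then nrm t else 0
                         | inr k => rho k * `|v k| end).
rewrite !big_sumType /=.
have -> : \sum_s (if s == t then nrm t else 0) *: ((nrm s)^-1 *: y s) = y t.
  rewrite (bigD1 t)//= eqxx scalerKV ?lt0r_neq0// big1 ?addr0// => s /negPf ->.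
  by rewrite scale0r.
have -> : \sum_s `|if s == t then nrm t else 0| = nrm t.
  rewrite (bigD1 t)//= eqxx gtr0_norm// big1 ?addr0// => s /negPf ->.
  by rewrite normr0.
split.
  rewrite xy; congr +%R; apply: eq_bigr => k _.
  have [->|vk] := eqVneq (v k) 0; first by rewrite !scaler0.
  by rewrite scalerA mulfK// normr_eq0.
have -> : \sum_k `|rho k * `|v k| | = \sum_k rho k * `|v k|.
  by apply: eq_bigr => k _; rewrite ger0_norm// mulr_ge0//; case/andP: (rho_itv k).
lra.
Qed.

(** * Local complementation *)

(** [I] is bounded below since [|y| <= |j y| = |T (I y)|]. The local projection replaces each [u g]
    by [I (zeta g)], where Helly's theorem pulls [T (u g)] back to [zeta g]. *)
Lemma bidual_lift_locally_complemented (Z W D B : completeNormedModType RR)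
    (p1 : D -> Z -> RR) (p2 : B -> D -> RR) (j : Z -> B)
    (I : Z -> W) (T : W -> B) (LI LT : RR) :
  bidual_of p1 p2 j -> is_linear I -> is_linear T ->
  (forall y, `|I y| <= LI * `|y|) -> 0 <= LI ->
  (forall x, `|T x| <= LT * `|x|) -> 0 <= LT ->
  (forall y, T (I y) = j y) ->
  bounded_below I /\ locally_complemented (range I).
Proof.
move=> bd lI lT ILI LI0 TLT LT0 TI; have lj := bidual_linear bd; split.
  exists (LT + 1)^-1; split=> [|y]; first by rewrite invr_gt0 ltr_wpDl.
  rewrite ler_pdivrMl ?ltr_wpDl//; apply: le_trans (bidual_isometry y bd) _.
  by rewrite -TI (le_trans (TLT _))// ler_wpM2r// lerDl.
(* The factors bound [I], the vectors [zeta g] and the coefficients over [u]; the summand 1 ensures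
   [1 <= lam]. *)
exists (1 + LI * ((LT + 1) * 3)); split.
  by rewrite lerDl !mulr_ge0 ?addr_ge0.
move=> n v eps eps0; have [m [u [u1 uP]]] := span_polytope v.
have wLT g : `|T (u g)| <= LT by rewrite (le_trans (TLT _))// ler_piMr.
have [zeta [zetaL zetaP]] := bidual_helly bd LT0 ltr01 wLT.
have zetaI a z : \sum_g a g *: u g = I z -> \sum_g a g *: zeta g = z.
  move=> az; apply: zetaP; rewrite -TI -az (lin_sum lT).
  by apply: eq_bigr => g _; rewrite (linZ lT).
have /choice[a aP] x : exists a : 'I_m -> RR, span_of v x ->
    x = \sum_g a g *: u g /\ \sum_g `|a g| <= 3 * `|x|.
  have [vx|nvx] := pselect (span_of v x); last by exists (fun=> 0).
  by have [a aP] := uP x vx; exists a.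
pose S x := \sum_g a x g *: zeta g.
have vlin c x y : span_of v x -> span_of v y -> span_of v (c *: x + y).
  move=> [b _ <-] [b' _ <-]; exists (fun k => c * b k + b' k) => //.
  rewrite scaler_sumr -big_split; apply: eq_bigr => k _.
  by rewrite scalerDl scalerA.
exists (I \o S); split=> [c x y vx vy|x vx|x vx [z _ zx]|x vx] /=.
- rewrite -lI; congr I; apply/eqP; rewrite -subr_eq0; apply/eqP.
  (* The coefficients [a x] are merely chosen, not linear in [x]. Their defect [b] satisfies
     [\sum_g b g *: u g = I 0], a relation that [zeta] preserves. *)
  pose b g := a (c *: x + y) g - (c * a x g + a y g).
  have bE (E : lmodType RR) (e : 'I_m -> E) : \sum_g b g *: e g =
      \sum_g a (c *: x + y) g *: e g -
      (c *: (\sum_g a x g *: e g) + \sum_g a y g *: e g).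
    rewrite scaler_sumr -big_split -sumrB; apply: eq_bigr => g _ /=.
    by rewrite /b scalerBl scalerDl scalerA.
  rewrite -bE; apply: zetaI; rewrite bE (lin0 lI).
  rewrite -(aP _ (vlin c _ _ vx vy)).1 -(aP _ vx).1 -(aP _ vy).1.
  by rewrite subrr.
- by exists (S x).
- by rewrite -zx; congr I; apply: zetaI; rewrite -(aP _ _).1 zx.
apply: (@le_trans _ _ ((LI * ((LT + 1) * 3)) * `|x|)); last first.
  by rewrite ler_wpM2r// -addrA addrCA lerDl addr_ge0// ltW.
rewrite -!mulrA; apply: le_trans (ILI _) _; rewrite ler_wpM2l//.
apply: (@le_trans _ _ (\sum_g (LT + 1) * `|a x g|)).
  apply: le_trans (ler_norm_sum _ _ _) _; apply: ler_sum => g _.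
  by rewrite normrZ mulrC ler_wpM2r.
by rewrite -mulr_sumr ler_wpM2l ?addr_ge0//; case: (aP _ vx).
Qed.

(** * Ultrafilter limits and extension into dual spaces *)

Lemma ultra_bounded_cvg (T : Type) (U : set_system T) (f : T -> RR) (M : RR) :
  UltraFilter U -> U [set s | `|f s| <= M] ->
  exists l : RR, `|l| <= M /\ f @ U --> l.
Proof.
move=> UU UM.
have UfM : U (f @^-1` [set` `[- M, M]]).
  by apply: filterS UM => s /=; rewrite in_itv/= -ler_norml.
have [l []] := segment_compact (fmap_proper_filter f _) UfM.
rewrite /= in_itv/= -ler_norml => lM cl; exists l; split=> // N Nl.
(* A cluster point of an ultrafilter is a limit: otherwise the complement of some neighbourhood [N]
   belongs to it and meets [N]. *)
have [//|UC] := in_ultra_setVsetC (f @^-1` N) UU.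
by have [x [/= + Nx]] := cl (~` N) N UC Nl.
Qed.

Lemma near_cvg_unique (T : Type) (U : set_system T) (f g : T -> RR) (l k : RR) :
  ProperFilter U -> (\forall s \near U, f s = g s) ->
  f @ U --> l -> g @ U --> k -> l = k.
Proof.
move=> PU fg fl gk; have fk : f @ U --> k.
  by apply: (cvg_trans _ gk); apply: near_eq_cvg; apply: filterS fg => s ->.
exact: (cvg_unique (@Rhausdorff RR) fl fk).
Qed.

Lemma near_lincomb_lim (T : Type) (U : set_system T) (f g k : T -> RR)
    (a l m n : RR) :
  ProperFilter U -> (\forall s \near U, f s = a * g s + k s) ->
  f @ U --> l -> g @ U --> m -> k @ U --> n -> l = a * m + n.
Proof.
move=> PU fgk fl gm kn.
have h := cvgD (cvgMl_tmp (a := a) gm) kn.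
exact: (near_cvg_unique PU fgk fl (h _ _)).
Qed.

(* An extension is obtained as a limit of the maps [t \o I^-1 \o T_s] along an
   ultrafilter on the finite-dimensional subspaces [s]; the limit exists
   pointwise on the predual since bounded sets of [RR] are relatively compact. *)
Lemma locally_complemented_extension (V X W Z : completeNormedModType RR)
    (p : W -> Z -> RR) (I : V -> X) (t : V -> W) (L : RR) :
  dual_pairing p -> is_linear I -> bounded_below I ->
  locally_complemented (range I) ->
  is_linear t -> 0 <= L -> (forall y, `|t y| <= L * `|y|) ->
  exists h : X -> W, [/\ is_linear h,
    exists M, 0 <= M /\ forall x, `|h x| <= M * `|x| &
    forall y, h (I y) = t y].
Proof.
move=> pP lI [c [c0 cI]] [lam [lam1 lamP]] lt L0 tL.
have [plin plinl _ _] := pP.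
have injI : injective I.
  move=> x y Ixy; apply/eqP; rewrite -subr_eq0 -normr_le0 -(pmulr_rle0 _ c0).
  by rewrite (le_trans (cI _))// (linB lI) Ixy subrr normr0.
pose sp (s : seq X) := span_of (tnth (in_tuple s)).
have /choice[S SP] s : exists S : X -> X,
    [/\ forall a x y, sp s x -> sp s y -> S (a *: x + y) = a *: S x + S y,
        forall x, sp s x -> range I (S x),
        forall x, sp s x -> range I x -> S x = x &
        forall x, sp s x -> `|S x| <= (lam + 1) * `|x|].
  exact: lamP ltr01.
(* [G] inverts [I] on its range and is 0 elsewhere. *)
have /choice[G GP] x : exists y, range I x -> I y = x.
  have [[y _ yx]|nx] := pselect (range I x); first by exists y.
  by exists 0.
pose g s x := t (G (S s x)).
(* The factors bound [t], the inverse of [I], and the local projections taken with [eps = 1]. *)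
pose M := L * (c^-1 * (lam + 1)).
have M0 : 0 <= M.
  by rewrite !mulr_ge0 ?invr_ge0 ?(ltW c0)//; lra.
have gM s x : sp s x -> `|g s x| <= M * `|x|.
  move=> sx; have [_ rS _ bS] := SP s.
  rewrite (le_trans (tL _))// -!mulrA ler_wpM2l// ler_pdivlMl//.
  rewrite (le_trans (cI _))// GP; last exact: rS.
  exact: bS.
have glin s a x y : sp s x -> sp s y -> sp s (a *: x + y) ->
    g s (a *: x + y) = a *: g s x + g s y.
  move=> sx sy sxy; have [lS rS _ _] := SP s; rewrite -lt; congr t.
  apply: injI; rewrite lI !GP; [exact: lS|exact: rS..].
have gI s y : sp s (I y) -> g s (I y) = t y.
  move=> sy; have [_ _ idS _] := SP s; rewrite /g idS//.
  by congr t; apply: injI; rewrite GP//; exists y.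
(* Finite sequences stand for the subspaces they span. Along [F0] every given vector eventually
   belongs to [s], so the linearity of [g s] on [sp s] passes to the limit. *)
pose F0 : set_system (seq X) :=
  [set P : set (seq X) |
    exists s0 : seq X, forall s : seq X, {subset s0 <= s} -> P s].
have F0F : ProperFilter F0.
  apply: Build_ProperFilter_ex => [P [s0 Ps0]|]; first by exists s0; exact: Ps0.
  split=> [|P Q [s1 Ps1] [s2 Qs2]|P Q PQ [s0 Ps0]].
  - by exists [::].
  - exists (s1 ++ s2) => s s12; split; [apply: Ps1|apply: Qs2] => x xs;
      by apply: s12; rewrite mem_cat xs ?orbT.
  - by exists s0 => s /Ps0; exact: PQ.
have [U [UU F0U]] := ultraFilterLemma F0F.
have UF : ProperFilter U by exact: ultra_proper.
have Usp x : \forall s \near U, sp s x.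
  apply: F0U; exists [:: x] => s xs.
  have /(tnthP (in_tuple s))[i xi] : x \in in_tuple s.
    by apply: xs; rewrite mem_head.
  exists (fun k => (k == i)%:R) => //.
  rewrite (bigD1 i)//= eqxx scale1r -xi big1 ?addr0// => k /negPf ->.
  by rewrite scale0r.
have /choice[l lP] (xz : X * Z) : exists l : RR,
    `|l| <= M * `|xz.1| * `|xz.2| /\ (fun s => p (g s xz.1) xz.2) @ U --> l.
  apply: ultra_bounded_cvg; near=> s => /=.
  apply: le_trans (dual_le pP _ _) _; rewrite ler_wpM2r//; apply: gM.
  by near: s; exact: Usp.
have /choice[h hP] x : exists w, forall z, p w z = l (x, z).
  apply: (dual_repr pP (c := M * `|x|)) => [a z z'|z]; last exact: (lP (x, z)).1.
  apply: near_lincomb_lim (lP (x, a *: z + z')).2 (lP (x, z)).2 (lP (x, z')).2.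
  by near=> s => /=; rewrite plin.
exists h; split=> [a x y||y]; last 2 first.
- exists M; split=> // x; apply: (dual_norm_le pP) => [|z].
    by rewrite mulr_ge0.
  by rewrite hP; exact: (lP (x, z)).1.
- apply: (dual_inj pP) => z; rewrite hP.
  apply: near_cvg_unique (lP (I y, z)).2 (cvg_cst (p (t y) z)).
  by near=> s; rewrite /= gI//; near: s; exact: Usp.
apply: (dual_inj pP) => z; rewrite plinl !hP.
apply: near_lincomb_lim (lP (a *: x + y, z)).2 (lP (x, z)).2 (lP (y, z)).2.
near=> s => /=; rewrite glin ?plinl//; by near: s; exact: Usp.
Unshelve. all: by end_near. Qed.

(** * Composition of morphisms and the equivalence *)

Lemma lipschitz_comp (X Y Z : Type) (dX : X -> X -> RR) (dY : Y -> Y -> RR)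
    (dZ : Z -> Z -> RR) (f : X -> Y) (g : Y -> Z) :
  Defs.lipschitz dX dY f -> Defs.lipschitz dY dZ g ->
  Defs.lipschitz dX dZ (g \o f).
Proof.
move=> [K [K0 fK]] [L [L0 gL]]; exists (L * K); split; first exact: mulr_ge0.
move=> x y; apply: le_trans (gL _ _) _.
by rewrite -mulrA ler_wpM2l//; exact: fK.
Qed.

Lemma is_mor_comp (C : macat) (X Y Z : maobj C) (f : X -> Y) (g : Y -> Z) :
  is_mor f -> is_mor g -> is_mor (g \o f).
Proof.
move=> [fl fo] [gl go]; split; first exact: lipschitz_comp fl gl.
by move=> k xs; rewrite /= fo go.
Qed.

Lemma is_bmor_comp (C : bcat) (X Y Z : bobj C) (f : X -> Y) (g : Y -> Z) :
  is_bmor f -> is_bmor g -> is_bmor (g \o f).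
Proof.
move=> [flin fl fo] [glin gl go]; split.
- by move=> a x y; rewrite /= flin glin.
- exact: lipschitz_comp fl gl.
- by move=> k xs; rewrite /= fo go.
Qed.

Lemma linear_is_mor (C1 : macat) (lc : forall i : sidx (ma_sig C1), 'I_(sar i) -> RR)
    (Hlc : banach_in lc) (C2 : bcat) (V W : bobj C2) (T : V -> W) :
  is_linear T -> Defs.lipschitz (@normdist V) (@normdist W) T ->
  @is_mor C1 (as_cat1 Hlc V) (as_cat1 Hlc W) T.
Proof.
move=> lT TL; split=> // k xs; rewrite [LHS](lin_sum lT).
by apply: eq_bigr => g _; rewrite (linZ lT).
Qed.

Theorem theorem4p1
  (* Cat1 ⊇ Banach ⊇ Cat2 *)
  (C1 : macat) (lc : forall i : sidx (ma_sig C1), 'I_(sar i) -> RR)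
  (Hlc : banach_in lc) (C2 : bcat) (HC2inv : b_iso_invariant C2)
  (Hnice : nice C1) (Hbid : closed_under_biduals C2)
  (* free objects and the functor F *)
  (F : maobj C1 -> bobj C2) (delta : forall X : maobj C1, X -> F X)
  (Hfree : forall X : maobj C1, is_free_obj Hlc (delta X))
  (* the morphism i : N -> M and F[i] *)
  (N M : maobj C1) (i : N -> M) (Hi : is_mor i)
  (Fi : F N -> F M) (HFi : is_bmor Fi) (HFidelta : forall x, Fi (delta N x) = delta M (i x))
  (* the bidual F[N]** with its Cat2-structure and canonical embedding j *)
  (D B : completeNormedModType RR) (p1 : D -> F N -> RR) (p2 : B -> D -> RR)
  (j : F N -> B) (Hbd : bidual_of p1 p2 j)
  (oB : opsT (b_sig C2) B) (HoB : @b_ax C2 B oB) (Hj : @is_bmor C2 (F N) (BObj HoB) j) :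
  let P1 := bounded_below Fi /\ locally_complemented (range Fi) in
  let P2 := forall (W Z : completeNormedModType RR) (p : W -> Z -> RR),
              dual_pairing p ->
              forall (oW : opsT (b_sig C2) W) (HoW : @b_ax C2 W oW) (f : N -> W),
                @is_mor C1 N (as_cat1 Hlc (BObj HoW)) f ->
                exists h : M -> W,
                  @is_mor C1 M (as_cat1 Hlc (BObj HoW)) h /\ forall x, h (i x) = f x in
  let P3 := exists h : M -> B,
              @is_mor C1 M (as_cat1 Hlc (BObj HoB)) h /\
              forall x, h (i x) = j (delta N x) in
  let P4 := exists T : F M -> B,
              @is_bmor C2 (F M) (BObj HoB) T /\ forall y, T (Fi y) = j y in
  [/\ P1 <-> P2, P2 <-> P3 & P3 <-> P4].
Proof.
move=> P1 P2 P3 P4.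
have dN : @is_mor C1 N (as_cat1 Hlc (F N)) (delta N) := (Hfree N).1.
have dM : @is_mor C1 M (as_cat1 Hlc (F M)) (delta M) := (Hfree M).1.
have [lFi FiL FiC] := HFi.
have [lj jL jC] := Hj.
(* The linearization of [f] on [F N] is extended to [F M] as a bounded operator, which is enough for
   a [C1]-morphism. *)
have P12 : P1 -> P2.
  move=> [Fib Fic] W Z p pP oW HoW f fN.
  have [Tf [[lTf TfL _] Tfd _ _]] := (Hfree N).2 (BObj HoW) f fN.
  have [L [L0 TfLn]] := normr_lipschitz lTf TfL.
  have [h [lh [K [K0 hK]] hFi]] :=
    locally_complemented_extension pP lFi Fib Fic lTf L0 TfLn.
  exists (h \o delta M); split=> [|x]; last by rewrite /= -HFidelta hFi Tfd.
  apply: (is_mor_comp dM); apply: linear_is_mor => //.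
  exact: lipschitz_normr lh K0 hK.
(* The bidual [B] is the dual of [D]. *)
have P23 : P2 -> P3.
  move=> /(_ B D p2); case: Hbd => _ p2P _ /(_ p2P oB HoB (j \o delta N)).
  by apply; apply: (is_mor_comp dN); exact: linear_is_mor.
have P34 : P3 -> P4.
  move=> [h [hm hi]].
  have [T [TM Td _ _]] := (Hfree M).2 (BObj HoB) h hm.
  exists T; split=> // y.
  have jm : @is_mor C1 N (as_cat1 Hlc (BObj HoB)) (j \o delta N).
    by apply: (is_mor_comp dN); exact: linear_is_mor.
  have [S [_ _ _ Su]] := (Hfree N).2 (BObj HoB) _ jm.
  (* Both [T \o Fi] and [j] are [C2]-morphisms extending [j \o delta N], so uniqueness identifies
     them. *)
  have TS : T \o Fi = S.
    apply: Su => [|x]; first exact: is_bmor_comp HFi TM.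
    by rewrite /= HFidelta Td hi.
  have jS : j = S by exact: Su.
  by rewrite jS -TS.
have P43 : P4 -> P3.
  move=> [T [[lT TL TC] TFi]]; exists (T \o delta M); split=> [|x].
    by apply: (is_mor_comp dM); exact: linear_is_mor.
  by rewrite /= -HFidelta TFi.
have P41 : P4 -> P1.
  move=> [T [[lT TL TC] TFi]].
  have [LI [LI0 FiLn]] := normr_lipschitz lFi FiL.
  have [LT [LT0 TLn]] := normr_lipschitz lT TL.
  exact: bidual_lift_locally_complemented Hbd lFi lT FiLn LI0 TLn LT0 TFi.
by split; split; auto.
Qed.
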